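(* Let $n\ge 1$ be an integer and let $\mathcal{P}^{\circ(-1)}=\left[\frac{i!\,j!}{(i+j)!}\right]_{i,j=0}^{n-1}$ be the Hadamard (entrywise) inverse of the $n\times n$ Pascal matrix $\mathcal{P}=\left[\frac{(i+j)!}{i!\,j!}\right]_{i,j=0}^{n-1}$. Then $$\mathrm{Inertia}\left(\mathcal{P}^{\circ(-1)}\right)=\begin{cases}\left(\dfrac n2,\,0,\,\dfrac n2\right) & \text{if } n \text{ is even},\\[2mm] \left(\dfrac{n+1}{2},\,0,\,\dfrac{n-1}{2}\right) & \text{if } n\text{ is odd},\end{cases}$$ and $\mathcal{P}^{\circ(-1)}$ is Birkhoff-James orthogonal to the $n\times n$ identity matrix $I$ in the trace norm if and only if $n$ is even.
   Context: For a real symmetric matrix $A$, let $\pi(A),\xi(A),\nu(A)$ denote the number of positive, zero and negative eigenvalues of $A$, respectively (counted with multiplicity). The inertia of $A$ is the triplet $\mathrm{Inertia}(A)=(\pi(A),\xi(A),\nu(A))$. Let $\|\cdot\|_1$ denote the trace norm (sum of singular values) on the space of $n\times n$ real matrices. For $n\times n$ real matrices $X,Y$, $X$ is said to be Birkhoff-James orthogonal to $Y$ in the trace norm if $\|X+tY\|_1\ge \|X\|_1$ for all $t\in\mathbb{R}$. *)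

(* Defs.v *)
From HB Require Import structures.
From mathcomp Require Import all_boot all_order all_algebra.
From mathcomp Require Import reals.
From mathcomp Require Import polyrcf.
Set Implicit Arguments.
Unset Strict Implicit.
Unset Printing Implicit Defensive.
Import Order.TTheory GRing.Theory Num.Theory.
Local Open Scope ring_scope.

(* The real eigenvalues of A, each repeated according to its multiplicity as a
   root of the characteristic polynomial; [rootsR p] lists the distinct real
   roots of p. For symmetric A these are all the eigenvalues of A. *)
Definition spectrum (R : realType) (n : nat) (A : 'M[R]_n) : seq R :=
  flatten [seq nseq (mup x (char_poly A)) x | x <- rootsR (char_poly A)].

Definition num_pos_eig (R : realType) (n : nat) (A : 'M[R]_n) : nat :=
  count (fun x => 0 < x) (spectrum A).

Definition num_zero_eig (R : realType) (n : nat) (A : 'M[R]_n) : nat :=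
  count (fun x => x == 0) (spectrum A).

Definition num_neg_eig (R : realType) (n : nat) (A : 'M[R]_n) : nat :=
  count (fun x => x < 0) (spectrum A).

(* Meaningful for symmetric A. *)
Definition inertia (R : realType) (n : nat) (A : 'M[R]_n) : nat * nat * nat :=
  (num_pos_eig A, num_zero_eig A, num_neg_eig A).

Definition singular_values (R : realType) (n : nat) (A : 'M[R]_n) : seq R :=
  [seq Num.sqrt x | x <- spectrum (A^T *m A)].

Definition trace_norm (R : realType) (n : nat) (A : 'M[R]_n) : R :=
  \sum_(s <- singular_values A) s.

Definition BJ_orthogonal (R : realType) (n : nat) (N : 'M[R]_n -> R)
    (X Y : 'M[R]_n) : Prop :=
  forall t : R, N X <= N (X + t *: Y).

Definition pascal (R : realType) (n : nat) : 'M[R]_n :=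
  \matrix_(i < n, j < n) ((i + j)`!%:R / (i`! * j`!)%:R).

Definition hadamard_inv (R : realType) (n : nat) (A : 'M[R]_n) : 'M[R]_n :=
  map_mx (fun x => x^-1) A.

Lemma count_mem_spectrum (R : realType) (n : nat) (A : 'M[R]_n) (x : R) :
  count_mem x (spectrum A) = mup x (char_poly A).
Proof.
have p0 : char_poly A != 0 by rewrite monic_neq0 ?char_poly_monic.
rewrite /spectrum count_flatten -map_comp sumnE big_map.
under eq_bigr do rewrite /= count_nseq /=.
have [xr|xNr] := boolP (x \in rootsR (char_poly A)).
  rewrite (bigD1_seq x) ?uniq_roots //= eqxx mul1n big1 ?addn0 // => y.
  by move=> /negPf ->.
rewrite big1_seq => [|y /andP[_ yr]]; last first.
  by case: eqP => // yx; rewrite -yx yr in xNr.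
apply/esym/eqP; rewrite -leqn0 leqNgt mup_geq // expr1 dvdp_XsubCl.
by have := roots_on_rootsR p0 x; rewrite (negPf xNr) /= => ->.
Qed.

Lemma hadamard_inv_pascalE (R : realType) (n : nat) (i j : 'I_n) :
  hadamard_inv (pascal R n) i j = (i`! * j`!)%:R / (i + j)`!%:R.
Proof. by rewrite !mxE invf_div. Qed.

(* Main.v *)
Require Import Defs.
From mathcomp Require Import all_boot all_order all_algebra.
From mathcomp Require Import reals.
From mathcomp Require Import complex.
From mathcomp Require Import ring zify.
Import Order.TTheory GRing.Theory Num.Theory.
Local Open Scope ring_scope.
Local Open Scope sesquilinear_scope.

(** The sum over j of (-1)^j C(m,j) (m - 1 + j)! / (k + j)! is, up to sign, an
   m-th finite difference of a polynomial in j of degree m - 1 - k, so it is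
   zero when k < m; it is positive when k = m. The coefficients
   (-1)^j C(m,j) (m - 1 + j)! therefore give a lower triangular matrix L such
   that L (P^o(-1)) L^T is diagonal with entries of alternating signs, and
   Sylvester's law yields the inertia. The eigenvalues d_i of a symmetric A
   satisfy ||A + t I||_1 = sum_i |d_i + t|; when no d_i vanishes this is
   minimal at t = 0 exactly when as many d_i are positive as negative. *)

(** * Spectra and trace norms read off a diagonalization *)

Lemma char_poly_similar {F : comUnitRingType} {n : nat} (P A : 'M[F]_n) :
  P \in unitmx -> char_poly (invmx P *m A *m P) = char_poly A.
Proof.
move=> uP; pose C := map_mx (@polyC F).
have CP : C _ _ (invmx P) *m C _ _ P = 1%:M.
  by rewrite -map_mxM mulVmx // map_mx1.
rewrite /char_poly /char_poly_mx !map_mxM.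
suff -> : 'X%:M - C _ _ (invmx P) *m C _ _ A *m C _ _ P
   = C _ _ (invmx P) *m ('X%:M - C _ _ A) *m C _ _ P.
  by rewrite !det_mulmx mulrAC -det_mulmx CP det1 mul1r.
by rewrite mulmxBr mulmxBl scalar_mxC -[X in _ = X - _]mulmxA CP mulmx1.
Qed.

Lemma perm_spectrum {R : realType} {n : nat} (A : 'M[R]_n) (s : seq R) :
  char_poly A = \prod_(x <- s) ('X - x%:P) -> perm_eq (spectrum A) s.
Proof.
move=> cA; apply/allP => x _ /=.
by rewrite count_mem_spectrum cA mu_prod_XsubC.
Qed.

Local Notation toC := (real_complex _).

(** The diagonal is real, but [P] is complex because it comes from the spectral theorem for
    Hermitian matrices. Invertibility of [P] is enough to read off the spectrum with
    multiplicities. *)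
Definition complex_similar_diag {R : realType} {n : nat} (A : 'M[R]_n)
    (d : 'rV[R]_n) : Prop :=
  exists2 P : 'M[R[i]]_n, P \in unitmx &
    map_mx toC A = invmx P *m diag_mx (map_mx toC d) *m P.

Lemma perm_spectrum_similar {R : realType} {n : nat} (A : 'M[R]_n)
    (d : 'rV[R]_n) :
  complex_similar_diag A d -> perm_eq (spectrum A) [seq d 0 i | i : 'I_n].
Proof.
move=> [P uP AE]; apply: perm_spectrum.
apply: (map_poly_inj toC); rewrite map_char_poly AE char_poly_similar //.
rewrite char_poly_trig ?diag_mx_is_trig // rmorph_prod big_image /=.
apply: eq_bigr => i _.
by rewrite rmorphB /= map_polyX map_polyC /= !mxE eqxx.
Qed.

Lemma similar_diag_shift {R : realType} {n : nat} (A : 'M[R]_n) (d : 'rV[R]_n)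
    (t : R) :
  complex_similar_diag A d ->
  complex_similar_diag (A + t *: 1%:M) (d + const_mx t).
Proof.
move=> [P uP AE]; exists P => //.
rewrite !map_mxD map_mxZ /= map_mx1 map_const_mx raddfD /= diag_const_mx.
by rewrite mulmxDr mulmxDl -AE scalar_mxC -mulmxA mulVmx // mulmx1 scalemx1.
Qed.

Lemma similar_diag_sqr {R : realType} {n : nat} (A : 'M[R]_n) (d : 'rV[R]_n) :
  complex_similar_diag A d ->
  complex_similar_diag (A *m A) (map_mx (fun x => x ^+ 2) d).
Proof.
move=> [P uP AE]; exists P => //.
rewrite map_mxM AE -!mulmxA mulKVmx // !mulmxA; congr (_ *m _).
rewrite -mulmxA; congr (_ *m _); rewrite mul_diag_mx.
by apply/matrixP => i j; rewrite !mxE rmorphXn /= mulrnAr expr2.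
Qed.

(** By symmetry [A^T *m A] is the square of [A], with eigenvalues d_i^2, whose square roots are
    |d_i|. *)
Lemma trace_norm_symmetric {R : realType} {n : nat} (A : 'M[R]_n)
    (d : 'rV[R]_n) :
  A^T = A -> complex_similar_diag A d -> trace_norm A = \sum_i `|d 0 i|.
Proof.
move=> symA /similar_diag_sqr/perm_spectrum_similar AAd.
rewrite /trace_norm /singular_values symA (perm_big _ (perm_map _ AAd)) big_map.
by rewrite big_image; apply: eq_bigr => i _; rewrite mxE sqrtr_sqr.
Qed.

Lemma real_symmetric_spectral {R : realType} {n : nat} (A : 'M[R]_n) :
  A^T = A -> exists2 P : 'M[R[i]]_n, P \is unitarymx &
    exists d : 'rV[R]_n, map_mx toC A = invmx P *m diag_mx (map_mx toC d) *m P.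
Proof.
move=> symA; set B := map_mx toC A.
have Bherm : B \is hermsymmx.
  apply: realsym_hermsym.
    apply/is_hermitianmxP.
    by rewrite expr0 scale1r map_mx_id // /B map_trmx symA.
  by apply/mxOverP => i j; rewrite mxE complex_real.
have dreal := hermitian_spectral_diag_real Bherm.
have /hermitian_normalmx/orthomx_spectralP BE := Bherm.
exists (spectralmx B); first exact: spectral_unitarymx.
(* The eigenvalues of a Hermitian matrix are real, so taking real parts loses nothing. *)
exists (map_mx (@complex.Re R) (spectral_diag B)).
suff -> : map_mx toC (map_mx (@complex.Re R) (spectral_diag B)) =
  spectral_diag B by [].
apply/matrixP => i j; rewrite !mxE; apply: RRe_real.
exact: (mxOverP dreal).
Qed.

(** * Sylvester's law of inertia for diagonal Hermitian forms *)

Lemma diag_formE {C : numClosedFieldType} {n : nat} (a : 'rV[C]_n)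
    (y : 'rV[C]_n) :
  (y *m diag_mx a *m y ^t*) 0 0 = \sum_i a 0 i * `|y 0 i| ^+ 2.
Proof.
rewrite mxE; apply: eq_bigr => i _.
by rewrite mul_mx_diag !mxE normCK mulrAC mulrC.
Qed.

(* If the inequality failed, some nonzero x would satisfy the
   n - #{a > 0} + #{b > 0} < n linear constraints making the form positive
   in the U coordinates and nonpositive in the V coordinates. *)
Lemma congruent_diag_pos_le {C : numClosedFieldType} {n : nat} (U V : 'M[C]_n)
    (a b : 'rV[C]_n) :
  U \in unitmx -> a \is a mxOver Num.real -> b \is a mxOver Num.real ->
  U *m diag_mx a *m U ^t* = V *m diag_mx b *m V ^t* ->
  (#|[pred i | (0 < a 0 i)%R]| <= #|[pred i | (0 < b 0 i)%R]|)%N.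
Proof.
move=> uU /mxOverP ra /mxOverP rb UV; rewrite leqNgt; apply/negP => ltba.
set pa := [pred i | 0 < a 0 i] in ltba; set pb := [pred i | 0 < b 0 i] in ltba.
pose S (p : pred 'I_n) (W : 'M[C]_n) :=
  colsub (fun k : 'I_#|p| => enum_val k) W.
pose M := row_mx (S (predC pa) U) (S pb V).
have SP p W (x : 'rV_n) i : x *m S p W = 0 -> p i -> (x *m W) 0 i = 0.
  move=> /rowP xW pi; have /(_ (enum_rank_in (pi : i \in p) i)) := xW.
  rewrite !mxE => E; rewrite -[RHS]E; apply: eq_bigr => k _.
  by rewrite mxE enum_rankK_in.
have rM : (\rank M < n)%N.
  apply: leq_ltn_trans (rank_leq_col _) _.
  by rewrite -[ltnRHS]card_ord -(cardC pa) addnC ltn_add2r.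
have : kermx M != 0 by rewrite kermx_eq0 /row_free neq_ltn rM.
case/rowV0Pn => x /sub_kermxP; rewrite mul_mx_row => /eqP.
rewrite row_mx_eq0 => /andP[/eqP xU /eqP xV] x0.
have := congr1 (fun W => (x *m W *m x ^t*) 0 0) UV; rewrite !mulmxA.
rewrite -2!(mulmxA (_ *m diag_mx _)) -!map_mxM -!trmx_mul !diag_formE => E.
have y0 : x *m U != 0.
  by apply: contra_neq x0 => /(congr1 (mulmx^~ (invmx U)));
    rewrite mulmxK // mul0mx.
have le0 : \sum_i b 0 i * `|(x *m V) 0 i| ^+ 2 <= 0.
  apply: sumr_le0 => i _; have [pbi|] := boolP (pb i).
    by rewrite (SP _ _ _ _ xV pbi) normr0 expr0n mulr0.
  rewrite /= -real_leNgt ?rb ?real0 // => bi.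
  by rewrite mulr_le0_ge0 // exprn_ge0.
have ge0 i : 0 <= a 0 i * `|(x *m U) 0 i| ^+ 2.
  have [pai|pai] := boolP (pa i).
    by rewrite mulr_ge0 ?exprn_ge0 // ltW.
  by rewrite (SP (predC pa) U x i xU pai) normr0 expr0n mulr0.
move: y0; rewrite -E in le0; case/rV0Pn => i yi.
have pai : pa i.
  by apply: contraNT yi => pai; rewrite (SP (predC pa) U x i xU pai).
have pos_i : 0 < a 0 i * `|(x *m U) 0 i| ^+ 2.
  by rewrite mulr_gt0 // exprn_gt0 // normr_gt0.
have : a 0 i * `|(x *m U) 0 i| ^+ 2 <= 0.
  by apply: le_trans le0; rewrite (bigD1 i) //= lerDl sumr_ge0.
by move=> /(lt_le_trans pos_i); rewrite ltxx.
Qed.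

(** * Alternating binomial sums as finite differences *)

(** Pascal's rule splits each coefficient in two. This reduces a difference of order m + 1 to one of
    order m, which drives the induction below. *)
Lemma binomial_altern_shift {R : comPzRingType} (m : nat) (f : nat -> R) :
  \sum_(j < m.+2) (-1) ^+ j * 'C(m.+1, j)%:R * f j =
  \sum_(j < m.+1) (-1) ^+ j * 'C(m, j)%:R * (f j - f j.+1).
Proof.
rewrite big_ord_recl.
under eq_bigr => j _ do rewrite /= /bump /= add1n binS natrD mulrDr mulrDl.
rewrite big_split /= addrA.
under [RHS]eq_bigr => j _ do rewrite mulrBr.
rewrite sumrB; congr (_ + _).
  rewrite [RHS]big_ord_recl [X in _ + X]big_ord_recr /= (@bin_small m m.+1) //.
  rewrite mulr0n mulr0 mul0r addr0.
  by rewrite !bin0; congr (_ + _); apply: eq_bigr.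
by rewrite -sumrN; apply: eq_bigr => j _; rewrite exprS mulN1r !mulNr.
Qed.

(** One difference of (a + j)! / (k + j)! is (k - a) (a + j)! / (k + 1 + j)!, the same shape with
    [k] raised by one. Induction on [m] with [k] free therefore collects the factors k + i - a. *)
Lemma binomial_factorial_sum {F : numFieldType} (m a k : nat) :
  \sum_(j < m.+1) (-1) ^+ j * 'C(m, j)%:R * ((a + j)`!%:R / (k + j)`!%:R) =
  (a`!%:R / (k + m)`!%:R) * \prod_(i < m) (k%:R + i%:R - a%:R) :> F.
Proof.
elim: m k => [|m IH] k.
  by rewrite big_ord1 big_ord0 bin0 !addn0 expr0 !mul1r mulr1.
rewrite (binomial_altern_shift m (fun j => (a + j)`!%:R / (k + j)`!%:R)).
rewrite big_ord_recl addr0 /=.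
have E j : (a + j)`!%:R / (k + j)`!%:R - (a + j.+1)`!%:R / (k + j.+1)`!%:R =
  (k%:R - a%:R) * ((a + j)`!%:R / (k.+1 + j)`!%:R) :> F.
  rewrite !addnS addSn !factS !natrM.
  have : (k + j)`!%:R != 0 :> F by rewrite pnatr_eq0 -lt0n fact_gt0.
  have : (k + j).+1%:R != 0 :> F by rewrite pnatr_eq0.
  by rewrite -!natr1 !natrD => h1 h2; field; rewrite h2 h1.
under eq_bigr => j _ do rewrite E mulrCA.
rewrite -mulr_sumr IH addSnnS mulrCA; congr (_ * (_ * _)).
apply: eq_bigr => i _; rewrite /bump add1n -!natr1; ring.
Qed.

(** * Shifted sums of absolute values, and sign counts *)

(** If the signs cancel, |d_i + t| >= sg(d_i) (d_i + t) sums to the bound. Conversely, near t = 0 no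
    sign changes, so the sum is affine in t, and a minimum at 0 forces its slope to vanish. *)
Lemma sum_abs_shift_min {R : realFieldType} {I : finType} (d : I -> R) :
  (forall i, d i != 0) ->
  (forall t, \sum_i `|d i| <= \sum_i `|d i + t|) <-> \sum_i Num.sg (d i) = 0.
Proof.
move=> d0; split => [minS | sg0 t]; last first.
  have -> : \sum_i `|d i| = \sum_i (`|d i| + Num.sg (d i) * t).
    by rewrite big_split /= -mulr_suml sg0 mul0r addr0.
  apply: ler_sum => i _; rewrite normrEsg -mulrDr.
  apply: le_trans (ler_norm _) _.
  by rewrite normrM normr_sg d0 mul1r.
(* Shifts of size at most [e] change no sign. The default 1 keeps [e] positive even when [I] is
   empty. *)
pose e := \big[Order.min/1]_i `|d i|.
have e0 : 0 < e.
  by rewrite /e; apply: lt_bigmin => // i _; rewrite normr_gt0.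
have le_e i : e <= `|d i| by apply: bigmin_le_cond.
(* The slope is [s]; moving against its sign by [e] changes the sum by -|s| e. *)
set s := \sum_i _; pose t := - Num.sg s * e.
have st : `|t| <= e.
  rewrite normrM normrN normr_sg (gtr0_norm e0).
  by apply: ler_piMl; [exact: ltW | rewrite lern1 leq_b1].
have := minS t.
have -> : \sum_i `|d i + t| = \sum_i (`|d i| + Num.sg (d i) * t).
  apply: eq_bigr => i _; have := le_trans st (le_e i); have := d0 i.
  case: (sgrP (d i)) => [->|di|di]; rewrite ?eqxx // => _.
    rewrite mul1r ler_norml => /andP[h _].
    by rewrite ger0_norm // -lerBlDl sub0r.
  rewrite mulN1r ler_norml => /andP[_ h].
  by rewrite ler0_norm ?opprD // -lerBrDl sub0r.
rewrite big_split /= -mulr_suml -/s lerDl.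
have -> : s * t = - (`|s| * e) by rewrite /t normrEsg; ring.
by rewrite oppr_ge0 pmulr_lle0 // normr_le0 => /eqP.
Qed.

Lemma sgr_sum_card {R : realDomainType} {I : finType} (d : I -> R) :
  \sum_i Num.sg (d i) =
  #|[pred i | 0 < d i]|%:R - #|[pred i | d i < 0]|%:R.
Proof.
rewrite -!sum1_card !natr_sum [X in _ = X - _]big_mkcond.
rewrite [X in _ - X]big_mkcond -sumrB; apply: eq_bigr => i _ /=.
by rewrite !inE; case: sgrP => _; rewrite ?subrr ?subr0 ?sub0r.
Qed.

Lemma card_sign_split {R : realDomainType} {I : finType} (d : I -> R) :
  (#|[pred i | (0 < d i)%R]| + #|[pred i | d i == 0%R]| +
   #|[pred i | (d i < 0)%R]|)%N = #|I|.
Proof.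
rewrite -!sum1_card [X in (X + _ + _)%N]big_mkcond.
rewrite [X in (_ + X + _)%N]big_mkcond [X in (_ + X)%N]big_mkcond.
rewrite -!big_split /=; apply: eq_bigr => i _.
by rewrite !inE; case: ltgtP.
Qed.

(** * Inertia under congruence, and orthogonality to the identity *)

Lemma congruent_diag_pos {C : numClosedFieldType} {n : nat} (U V : 'M[C]_n)
    (a b : 'rV[C]_n) :
  U \in unitmx -> V \in unitmx ->
  a \is a mxOver Num.real -> b \is a mxOver Num.real ->
  U *m diag_mx a *m U ^t* = V *m diag_mx b *m V ^t* ->
  #|[pred i | (0 < a 0 i)%R]| = #|[pred i | (0 < b 0 i)%R]|.
Proof.
move=> uU uV ra rb UV; apply/eqP; rewrite eqn_leq.
by rewrite (congruent_diag_pos_le U V) // (congruent_diag_pos_le V U).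
Qed.

Lemma congruent_diag_neg {C : numClosedFieldType} {n : nat} (U V : 'M[C]_n)
    (a b : 'rV[C]_n) :
  U \in unitmx -> V \in unitmx ->
  a \is a mxOver Num.real -> b \is a mxOver Num.real ->
  U *m diag_mx a *m U ^t* = V *m diag_mx b *m V ^t* ->
  #|[pred i | (a 0 i < 0)%R]| = #|[pred i | (b 0 i < 0)%R]|.
Proof.
move=> uU uV ra rb UV.
have oppP (c : 'rV[C]_n) :
    #|[pred i | (c 0 i < 0)%R]| = #|[pred i | (0 < (- c) 0 i)%R]|.
  by apply: eq_card => i; rewrite !inE mxE oppr_gt0.
rewrite !oppP; apply: (congruent_diag_pos U V) => //.
- by apply/mxOverP => i j; rewrite mxE rpredN (mxOverP ra).
- by apply/mxOverP => i j; rewrite mxE rpredN (mxOverP rb).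
- by rewrite !raddfN /= !mulNmx UV.
Qed.

Lemma count_spectrum {R : realType} {n : nat} (p : pred R) (A : 'M[R]_n)
    (d : 'rV[R]_n) :
  complex_similar_diag A d ->
  count p (spectrum A) = #|[pred i | p (d 0 i)]|.
Proof.
move=> /perm_spectrum_similar/permP->.
by rewrite count_map cardE [in RHS]/enum_mem size_filter enumT.
Qed.

(** A unitary [P] makes the spectral similarity a Hermitian congruence, so [d] and [b] have equally
    many positive and equally many negative entries. The zero counts agree because each triple adds
    up to n. *)
Lemma inertia_congruent {R : realType} {n : nat} (A L : 'M[R]_n)
    (b : 'rV[R]_n) :
  A^T = A -> L \in unitmx -> L *m A *m L^T = diag_mx b ->
  inertia A = (#|[pred i | (0 < b 0 i)%R]|, #|[pred i | b 0 i == 0]|,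
               #|[pred i | (b 0 i < 0)%R]|).
Proof.
move=> symA uL LAL; have [P Pu [d AE]] := real_symmetric_spectral A symA.
have uP := unitarymx_unit Pu.
have sd : complex_similar_diag A d by exists P.
rewrite /inertia /num_pos_eig /num_zero_eig /num_neg_eig.
rewrite !(count_spectrum _ _ _ sd).
have realC (c : 'rV[R]_n) : map_mx toC c \is a mxOver Num.real.
  by apply/mxOverP => i j; rewrite mxE complex_real.
have uV : map_mx toC (invmx L) \in unitmx by rewrite map_unitmx unitmx_inv.
have uU : P ^t* \in unitmx by rewrite -invmx_unitary // unitmx_inv.
have UV : P ^t* *m diag_mx (map_mx toC d) *m (P ^t*) ^t* =
   map_mx toC (invmx L) *m diag_mx (map_mx toC b) *m (map_mx toC (invmx L)) ^t*.
  rewrite trmxCK -invmx_unitary // -AE map_trmx -map_mx_comp.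
  rewrite (eq_map_mx toC) => [|x]; last exact: conjc_real.
  rewrite -map_diag_mx -!map_mxM -LAL; congr (map_mx _ _).
  by rewrite trmx_inv !mulmxA mulVmx // mul1mx mulmxK // unitmx_tr.
have pos := congruent_diag_pos _ _ _ _ uU uV (realC d) (realC b) UV.
have neg := congruent_diag_neg _ _ _ _ uU uV (realC d) (realC b) UV.
have posC (c : 'rV[R]_n) :
    #|[pred i | (0 < (map_mx toC c) 0 i)%R]| = #|[pred i | (0 < c 0 i)%R]|.
  by apply: eq_card => i; rewrite !inE mxE ltcR.
have negC (c : 'rV[R]_n) :
    #|[pred i | ((map_mx toC c) 0 i < 0)%R]| = #|[pred i | (c 0 i < 0)%R]|.
  by apply: eq_card => i; rewrite !inE mxE ltcR.
rewrite !posC in pos; rewrite !negC in neg.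
have := card_sign_split (d 0); rewrite -(card_sign_split (b 0)) pos neg.
by move=> /addIn/addnI->.
Qed.

Lemma BJ_orthogonal_id {R : realType} {n : nat} (A : 'M[R]_n) :
  A^T = A -> num_zero_eig A = 0%N ->
  BJ_orthogonal (@trace_norm R n) A 1%:M <-> num_pos_eig A = num_neg_eig A.
Proof.
move=> symA; have [P Pu [d AE]] := real_symmetric_spectral A symA.
have sd : complex_similar_diag A d by exists P => //; apply: unitarymx_unit.
rewrite /num_pos_eig /num_zero_eig /num_neg_eig !(count_spectrum _ _ _ sd).
move=> /card0_eq z0.
have d0 i : d 0 i != 0 by have /= := z0 i; rewrite !inE => ->.
have normE t : trace_norm (A + t *: 1%:M) = \sum_i `|d 0 i + t|.
  rewrite (trace_norm_symmetric _ (d + const_mx t)).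
  - by apply: eq_bigr => i _; rewrite !mxE.
  - by rewrite linearD linearZ /= symA trmx1.
  - exact: similar_diag_shift.
have BJE : BJ_orthogonal (@trace_norm R n) A 1%:M <->
    (forall t, \sum_i `|d 0 i| <= \sum_i `|d 0 i + t|).
  by split => h t; have := h t; rewrite normE (trace_norm_symmetric _ d).
apply: (iff_trans BJE); apply: (iff_trans (sum_abs_shift_min _ d0)).
rewrite sgr_sum_card; split => [/eqP | ->]; last by rewrite subrr.
by rewrite subr_eq0 eqr_nat => /eqP.
Qed.

(** * The triangular matrix that diagonalizes the Hadamard inverse *)

(* Row 0 is set apart because (m - 1 + j)! is meaningless at m = j = 0. *)
Definition orth_coef {F : numFieldType} (m j : nat) : F :=
  if m is k.+1 then (-1) ^+ j * 'C(m, j)%:R * (k + j)`!%:R else (j == 0)%N%:R.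

Lemma orth_coef_small {F : numFieldType} (m j : nat) :
  (m < j)%N -> orth_coef m j = 0 :> F.
Proof.
case: m => [|m] mj /=; first by rewrite gtn_eqF.
by rewrite bin_small // mulr0 mul0r.
Qed.

Lemma orth_coef_diag {F : numFieldType} (m : nat) :
  0 < (-1) ^+ m * orth_coef m m :> F.
Proof.
case: m => [|m] /=; first by rewrite mulr1 ltr01.
rewrite binn mulr1 mulrA -expr2 sqrr_sign mul1r ltr0n; exact: fact_gt0.
Qed.

(** This is [binomial_factorial_sum] at a = m, for row m + 1. *)
Lemma orth_coef_sum {F : numFieldType} (m k : nat) :
  \sum_(j < m.+2) orth_coef m.+1 j / (j + k)`!%:R =
  (m`!%:R / (k + m.+1)`!%:R) * \prod_(i < m.+1) (k%:R + i%:R - m%:R) :> F.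
Proof.
rewrite -binomial_factorial_sum; apply: eq_bigr => j _.
by rewrite /orth_coef -!mulrA (addnC m) (addnC k).
Qed.

Lemma orth_coef_sum_lt {F : numFieldType} (m k : nat) : (k < m)%N ->
  \sum_(j < m.+1) orth_coef m j / (j + k)`!%:R = 0 :> F.
Proof.
case: m => // m km; rewrite orth_coef_sum.
(* The factor of index m - k is k + (m - k) - m = 0. *)
have mk : (m - k < m.+1)%N by rewrite ltnS leq_subr.
by rewrite (bigD1 (Ordinal mk)) //= -natrD subnKC // subrr mul0r mulr0.
Qed.

Lemma orth_coef_sum_diag {F : numFieldType} (m : nat) :
  0 < \sum_(j < m.+1) orth_coef m j / (j + m)`!%:R :> F.
Proof.
case: m => [|m]; first by rewrite big_ord1 /= divr1 ltr01.
rewrite orth_coef_sum mulr_gt0 ?divr_gt0 ?ltr0n ?fact_gt0 //.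
apply: prodr_gt0 => i _; rewrite subr_gt0 -natrD ltr_nat; exact: leq_addr.
Qed.

(** Dividing column j by j! cancels the j! in the numerator of the entry j! k! / (j + k)!. *)
Definition orth_mx {F : numFieldType} (n : nat) : 'M[F]_n :=
  \matrix_(m, j) (orth_coef m j / j`!%:R).

Lemma fact_neq0 {F : numFieldType} (k : nat) : k`!%:R != 0 :> F.
Proof. by rewrite pnatr_eq0 -lt0n fact_gt0. Qed.

Lemma orth_mx_unit {F : numFieldType} (n : nat) : @orth_mx F n \in unitmx.
Proof.
rewrite unitmxE det_trig; last first.
  by apply/is_trig_mxP => i j ij; rewrite mxE orth_coef_small // mul0r.
rewrite unitfE; apply/prodf_neq0 => i _; rewrite mxE.
rewrite mulf_neq0 ?invr_eq0 ?fact_neq0 //.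
by apply: contraTneq (@orth_coef_diag F i) => ->; rewrite mulr0 ltxx.
Qed.

Lemma orth_mx_mul_pascal {R : realType} (n : nat) (m k : 'I_n) :
  (orth_mx n *m hadamard_inv (pascal R n)) m k =
  k`!%:R * \sum_(j < m.+1) orth_coef m j / (j + k)`!%:R.
Proof.
(* The sum over j <= m extends to all j < n, since the coefficients vanish beyond m. *)
rewrite mxE (big_ord_widen n (fun j => orth_coef m j / (j + k)`!%:R)) //.
rewrite [in RHS]big_mkcond mulr_sumr; apply: eq_bigr => j _.
rewrite hadamard_inv_pascalE mxE natrM ltnS; case: leqP => [_|mj].
  have j0 := @fact_neq0 R j; have jk0 := @fact_neq0 R (j + k).
  by field; rewrite jk0.
by rewrite orth_coef_small // !mul0r mulr0.
Qed.

Lemma hadamard_inv_pascal_sym {R : realType} (n : nat) :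
  (hadamard_inv (pascal R n))^T = hadamard_inv (pascal R n).
Proof.
by apply/matrixP => i j; rewrite mxE !hadamard_inv_pascalE mulnC addnC.
Qed.

(** Both [L *m A] and [L^T] are upper triangular, hence so is their product [B]; being symmetric,
    [B] is diagonal. *)
Lemma orth_mx_congr_pascal {R : realType} (n : nat) :
  exists2 b : 'rV[R]_n, (forall i : 'I_n, 0 < (-1) ^+ i * b 0 i) &
    orth_mx n *m hadamard_inv (pascal R n) *m (orth_mx n)^T = diag_mx b.
Proof.
set L := orth_mx n; set A := hadamard_inv _.
pose B := L *m A *m L^T.
have Bsym : B^T = B.
  by rewrite /B !trmx_mul trmxK hadamard_inv_pascal_sym mulmxA.
have BE (m l : 'I_n) : B m l = \sum_k (L *m A) m k * L l k.
  by rewrite mxE; apply: eq_bigr => k _; rewrite [L^T _ _]mxE.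
have LA0 (m k : 'I_n) : (k < m)%N -> (L *m A) m k = 0.
  by move=> km; rewrite orth_mx_mul_pascal orth_coef_sum_lt // mulr0.
have L0 (l k : 'I_n) : (l < k)%N -> L l k = 0.
  by move=> lk; rewrite mxE orth_coef_small // mul0r.
have B0 (m l : 'I_n) : (l < m)%N -> B m l = 0.
  move=> lm; rewrite BE big1 // => k _; have [kl|lk] := leqP k l.
    by rewrite LA0 ?mul0r // (leq_ltn_trans kl).
  by rewrite L0 ?mulr0.
exists (\row_i B i i) => [i|]; last first.
  rewrite -/B; apply/matrixP => i j; rewrite [RHS]mxE [X in X *+ _]mxE.
  case: (ltngtP j i) => [ji|ij|/val_inj->]; last by rewrite eqxx mulr1n.
    by rewrite B0 // gt_eqF.
  by rewrite -Bsym mxE B0 // lt_eqF.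
(* Only k = i survives in [B i i], leaving a positive sum times a diagonal entry of [L] of sign
   (-1)^i. *)
rewrite mxE BE (bigD1 i) //= big1 => [|k ki]; last first.
  case: (ltngtP i k) ki => [/L0->|/LA0->|/val_inj->];
    by rewrite ?mulr0 ?mul0r ?eqxx.
rewrite addr0 orth_mx_mul_pascal [L i i]mxE.
set S := \sum_(_ < _) _; have S0 : 0 < S by apply: orth_coef_sum_diag.
have -> : (-1) ^+ i * (i`!%:R * S * (orth_coef i i / i`!%:R)) =
    S * ((-1) ^+ i * orth_coef i i) :> R.
  by have := @fact_neq0 R i => h; field.
by rewrite mulr_gt0 // orth_coef_diag.
Qed.

(** * Counting signs and conclusion *)

Lemma card_even_ord (n : nat) : #|[pred i : 'I_n | ~~ odd i]| = uphalf n.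
Proof.
rewrite -sum1_card big_mkcond /=.
elim: n => [|n IH]; first by rewrite big_ord0.
rewrite big_ord_recr /= [X in (X + _)%N](_ : _ = uphalf n) //.
rewrite inE /= uphalf_half; case: (odd n) => /=; lia.
Qed.

Lemma inertia_hadamard_inv_pascal {R : realType} (n : nat) :
  inertia (hadamard_inv (pascal R n)) = (uphalf n, 0%N, n./2).
Proof.
have [b b_sign LAL] := @orth_mx_congr_pascal R n.
have bP (i : 'I_n) : (0 < b 0 i) = ~~ odd i /\ (b 0 i < 0) = odd i.
  have := b_sign i; rewrite -signr_odd; case: (odd i) => /=.
    by rewrite mulN1r oppr_gt0 => bi; rewrite bi lt_gtF.
  by rewrite mul1r => bi; rewrite bi lt_gtF.
rewrite (inertia_congruent _ _ _ (hadamard_inv_pascal_sym n)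
  (orth_mx_unit n) LAL).
have posE : #|[pred i | (0 < b 0 i)%R]| = uphalf n.
  by rewrite -card_even_ord; apply: eq_card => i; rewrite !inE (bP i).1.
have negE : #|[pred i | (b 0 i < 0)%R]| = n./2.
  have := cardC [pred i : 'I_n | ~~ odd i]; rewrite card_ord card_even_ord.
  rewrite uphalf_half -[RHS]odd_double_half -addnn -addnA => /addnI/addnI <-.
  by apply: eq_card => i; rewrite !inE (bP i).2 negbK.
have := card_sign_split (b 0); rewrite posE negE card_ord => sum_n.
congr (_, _, _); move: sum_n; rewrite uphalf_half.
by rewrite -[RHS]odd_double_half -addnn -!addnA => /addnI/addnI/(@addIn _ _ 0).
Qed.

Theorem mainTheorem6 (R : realType) (n : nat) (hn : (1 <= n)%N) :
  inertia (hadamard_inv (pascal R n)) =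
    (if odd n then (n.+1./2, 0%N, n.-1./2) else (n./2, 0%N, n./2))
  /\ (BJ_orthogonal (@trace_norm R n) (hadamard_inv (pascal R n)) 1%:M
      <-> ~~ odd n).
Proof.
have inertiaE := @inertia_hadamard_inv_pascal R n; split.
  rewrite inertiaE; case: n hn {inertiaE} => // n _ /=.
  by rewrite uphalf_half; case: (odd n) => /=; rewrite ?uphalf_half.
case: inertiaE => pos zero neg.
apply: (iff_trans (BJ_orthogonal_id _ (hadamard_inv_pascal_sym n) zero)).
(* The two counts differ by [odd n], so they agree exactly for even n. *)
by rewrite pos neg uphalf_half; case: (odd n); split => //; lia.
Qed.
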